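(* Let $p \in \mathbb{C}[z_1,\dots,z_d]$ be a pure stable polynomial with $p(0)=0$, with homogeneous expansion $p=\sum_{j\ge M} P_j$, where $P_j$ is homogeneous of degree $j$ and $P_M\not\equiv 0$. Suppose (as can always be arranged by replacing $p$ with a unimodular constant multiple) that $P_M$ has real coefficients. Let $A=\tfrac12(p+\bar p)$, $B=\tfrac1{2i}(p-\bar p)$, and let $A_M$ and $B_{M+1}$ be the lowest order homogeneous terms of $A$ and $B$ (of degrees $M$ and $M+1$ respectively). Then $A_M/B_{M+1}$ is a Pick function, i.e. $$\operatorname{Im}\left(\frac{A_M(z)}{B_{M+1}(z)}\right)\ge 0\quad\text{for all } z\in\mathbb{H}^d .$$
   Context: $\mathbb{H}=\{z\in\mathbb{C}:\operatorname{Im} z>0\}$. For a polynomial $p$, $\bar p(z)=\overline{p(\bar z_1,\dots,\bar z_d)}$. A polynomial $p\in\mathbb{C}[z_1,\dots,z_d]$ is pure stable if it has no zeros in $\mathbb{H}^d$ and has no nonconstant factor in common with $\bar p$. Under the stated normalization it is known that $A$ has lowest order homogeneous term $A_M=P_M$ and that $B$ vanishes to order exactly $M+1$ at $0$. The assertion that $A_M/B_{M+1}$ is a Pick function includes that it is analytic on $\mathbb{H}^d$ (i.e. $B_{M+1}$ has no zeros there). *)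

(* Defs.v *)
From HB Require Import structures.
From mathcomp Require Import all_boot all_order all_algebra complex.
(* The notations of mpoly and of mathcomp-analysis cannot be loaded together. *)
From mathcomp Require mpoly.
Export -(notations) mpoly.
From mathcomp Require Export reals topology normedtype derive.
Export numFieldNormedType.Exports.

Set Implicit Arguments.
Unset Strict Implicit.
Unset Printing Implicit Defensive.

Import Order.TTheory GRing.Theory Num.Theory.
Local Open Scope ring_scope.

(* C stands for the complex numbers: the theorem takes C := R[i] with
   R : realType.  ['Re z] and ['Im z] are elements of C that are real, and
   [0 < x] in C means that x is real and positive. *)
Section Defs.
Variables (C : numClosedFieldType) (d : nat).

Definition in_Hd (z : 'rV[C]_d) : Prop := forall i, 0 < 'Im (z ord0 i).

Definition peval (p : mpoly d C) (z : 'rV[C]_d) : C :=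
  meval (fun i => z ord0 i) p.

(* Coefficientwise conjugation; [pbarE] gives p-bar(z) = conj (p (conj z)). *)
Definition pbar (p : mpoly d C) : mpoly d C := map_mpoly Num.conj p.

Lemma pbarE (p : mpoly d C) (z : 'rV[C]_d) :
  peval (pbar p) z = (peval p (map_mx Num.conj z))^*.
Proof.
rewrite /peval [in RHS]mevalE rmorph_sum /pbar /map_mpoly /mmap raddf_sum.
apply: eq_bigr => m _ /=; rewrite mevalM mevalC rmorphM /=; congr (_ * _).
rewrite /mmap1 !rmorph_prod /=; apply: eq_bigr => i _.
by rewrite !rmorphXn /= mevalXU mxE conjCK.
Qed.

Definition pure_stable (p : mpoly d C) : Prop :=
  (forall z, in_Hd z -> peval p z != 0) /\
  (forall q r s : mpoly d C,
     p = q * r -> pbar p = q * s -> exists c, q = mpolyC d c).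

Definition hcomp (j : nat) (p : mpoly d C) : mpoly d C := pihomog mdeg j p.

Definition Apart (p : mpoly d C) : mpoly d C := 2^-1 *: (p + pbar p).

Definition Bpart (p : mpoly d C) : mpoly d C := (2 * 'i)^-1 *: (p - pbar p).

(* [differentiable] is taken over the field C, so it is complex (Frechet)
   differentiability; at every point of the open set H^d, this is analyticity. *)
Definition pick_function (f : 'rV[C]_d -> C) : Prop :=
  forall z, in_Hd z -> differentiable f z /\ 0 <= 'Im (f z).

End Defs.

(* Main.v *)
(* On a line x + zeta y with x real and y positive, the roots of p lie in the
   closed lower half plane, so |pbar| <= |p| on H^d, that is,
   Im (A * conj B) >= 0 there.  Comparing lowest order terms of A (t z) and
   B (t z) as t -> 0+ gives Im (A_M * conj B_k) >= 0 on H^d, where B_k is the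
   first nonzero homogeneous term of B; B is nonzero because p is pure.
   By Hurwitz, A_M = P_M has no zeros in H^d.  Near a zero of B_k the argument
   of B_k would take every value while that of A_M stays almost constant, so
   B_k has no zeros either.  Finally k = M + 1, since w |-> w^(k - M) must map
   the upper half plane into a half plane. *)
Require Import Defs.
From mathcomp Require Import all_boot all_order all_algebra complex ring.
Set Implicit Arguments.
Unset Strict Implicit.
Unset Printing Implicit Defensive.

Import Order.TTheory GRing.Theory Num.Theory.
Local Open Scope ring_scope.

(** The digit of index 0 is the residue mod [N], and induction gives the others. This is what lets
    the Kronecker substitution in [peval_eq0] separate monomials. *)
Lemma base_expansion_inj (N d : nat) (a b : 'I_d -> nat) :
    (forall i, a i < N)%N -> (forall i, b i < N)%N ->
    (\sum_(i < d) a i * N ^ i = \sum_(i < d) b i * N ^ i)%N -> a =1 b.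
Proof.
elim: d a b => [|d IH] a b a_lt b_lt; first by move=> _ [].
have shift (c : 'I_d.+1 -> nat) : (\sum_(i < d.+1) c i * N ^ i =
    (\sum_(i < d) c (lift ord0 i) * N ^ i) * N + c ord0)%N.
  rewrite big_ord_recl expn0 muln1 addnC big_distrl /=; congr (_ + _)%N.
  by apply: eq_bigr => i _; rewrite /bump /= add1n expnSr mulnA.
rewrite !shift => eq_ab.
have eq0 : a ord0 = b ord0.
  have := congr1 (modn^~ N) eq_ab.
  by rewrite /= !modnMDl !modn_small.
move: eq_ab; rewrite eq0 => /addIn /eqP.
have N_gt0 : (0 < N)%N by apply: leq_trans (a_lt ord0).
rewrite eqn_pmul2r // => /eqP /IH eqS i.
case: (unliftP ord0 i) => [j|] -> //.
by apply: (eqS).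
Qed.

(** * Restriction of polynomials to complex lines, and homogeneous components *)

Section Slices.
Variables (C : numClosedFieldType) (d : nat).
Implicit Types (p : mpoly d C) (z v : 'rV[C]_d) (F G : {poly C}).

(** The restriction to the line [z + t v] is kept as a polynomial in [t], so that root factorization
    and coefficient extraction apply to it. *)
Definition slice p z v : {poly C} :=
  mmap (@polyC C) (fun i => (z ord0 i)%:P + v ord0 i *: 'X) p.

Lemma horner_slice p z v t : (slice p z v).[t] = peval p (z + t *: v).
Proof.
rewrite /slice /peval mevalE /mmap horner_sum.
apply: eq_bigr => m _; rewrite hornerM hornerC /mmap1 horner_prod.
congr (_ * _); apply: eq_bigr => i _.
by rewrite horner_exp !mxE hornerD hornerZ hornerC hornerX [t * _]mulrC.
Qed.

(** The bound is uniform in [z] and [v], as the Hurwitz argument requires. *)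
Lemma size_slice p z v : (size (slice p z v) <= msize p)%N.
Proof.
rewrite /slice /mmap big_seq.
apply: (leq_trans (size_sum _ _ _)); apply/bigmax_leqP_seq => m _ m_p.
apply: leq_trans (msize_mdeg_lt m_p); rewrite mul_polyC.
apply: (leq_trans (size_scale_leq _ _)); rewrite /mmap1 mdegE.
elim/big_ind2: _ => [|F k G l|i _].
- by rewrite size_poly1.
- move=> hF hG; apply: (leq_trans (size_polyMleq _ _)).
  by have := leq_add hF hG; rewrite addSn addnS; case: (size F + size G)%N.
apply: (leq_trans (size_poly_exp_leq _ _)); rewrite ltnS.
rewrite -[leqRHS]mul1n leq_mul2r; apply/orP; right.
suff: (size ((z ord0 i)%:P + v ord0 i *: 'X)%R <= 2)%N by case: (size _).
apply: (leq_trans (size_polyD _ _)); rewrite geq_max.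
rewrite (leq_trans (size_polyC_leq1 _)) //=.
by rewrite (leq_trans (size_scale_leq _ _)) // size_polyX.
Qed.

Lemma mcoeff_hcomp j p m : mcoeff m (hcomp j p) = mcoeff m p *+ (mdeg m == j).
Proof.
rewrite /hcomp; elim/mpolyind: p => [|c m' p _ _ IH].
  by rewrite pihomog0 !mcoeff0 mul0rn.
rewrite linearP /= !mcoeffD !mcoeffZ IH mulrnDl; congr (_ + _).
rewrite pihomogX mcoeffX; case: (altP (m' =P m)) => [->|ne].
  by case: ifP => _; rewrite ?mcoeffX ?eqxx ?mcoeff0 ?mulr0.
by case: ifP => _; rewrite ?mcoeffX ?(negbTE ne) ?mcoeff0 mulr0 mul0rn.
Qed.

Lemma coef_slice0 p z j : (slice p 0 z)`_j = peval (hcomp j p) z.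
Proof.
rewrite /slice /peval /hcomp; elim/mpolyind: p => [|c m p _ _ IH].
  by rewrite pihomog0 mmap0 meval0 coef0.
rewrite linearP /= mmapD mmapZ mevalD mevalZ coefD IH coefCM; congr (_ * _ + _).
rewrite mmapX pihomogX /mmap1.
under eq_bigr => i _ do rewrite mxE polyC0 add0r exprZn.
rewrite scaler_prod coefZ -(big_morph _ (fun a b => exprD 'X a b) (expr0 _)).
rewrite -mdegE coefXn eq_sym; case: ifP => _; first by rewrite mevalX mulr1.
by rewrite meval0 mulr0.
Qed.

End Slices.

(** * One-variable polynomials: limits at 0, bounds from the location of roots, arguments near a
    zero *)

Section OneVariable.
Variable C : numClosedFieldType.
Implicit Types (F U V q : {poly C}) (e t : C).

Lemma poly_eq0_near0 F e :
  0 < e -> (forall t, 0 < t -> t < e -> F.[t] = 0) -> F = 0.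
Proof.
move=> e_gt0 F0; pose x (n : nat) : C := e / n.+2%:R.
have x_inj : injective x.
  move=> m n /(mulfI (lt0r_neq0 e_gt0)) /invr_inj /eqP.
  by rewrite eqr_nat => /eqP [].
apply: (@roots_geq_poly_eq0 _ F (map x (iota 0 (size F)))).
- apply/allP => _ /mapP [n _ ->]; apply/eqP/F0; rewrite /x.
    by rewrite divr_gt0.
  by rewrite ltr_pdivrMr // ltr_pMr // ltr1n.
- by rewrite map_inj_uniq // iota_uniq.
- by rewrite size_map size_iota.
Qed.

Lemma Im_le_norm (x : C) : 'Im x <= `|x|.
Proof.
have -> : 'Im x = 'Re (- 'i * x) by rewrite mulNr raddfN /= ReMil opprK.
by rewrite (le_trans (leif_Re_Creal _)) // normrM normrN normCi mul1r.
Qed.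

(** An algebraic form of the limit [t -> 0+]. Writing [F = G X + c], one has
    [Im F(t) = Im c + t Im G(t)] for real [t], with [Im G <= K] on (0, 1]; if [Im c < 0], this is
    negative for small [t]. *)
Lemma Im_horner0_ge0 F e :
  0 < e -> (forall t, 0 < t -> t < e -> 0 <= 'Im F.[t]) -> 0 <= 'Im F.[0].
Proof.
move=> e_gt0; elim/poly_ind: F => [|G c _] F_ge0; first by rewrite horner0 raddf0.
rewrite hornerMXaddC mulr0 add0r real_leNgt ?Creal_Im ?rpred0 //.
apply/negP => c_lt0.
pose K := 1 + \sum_(i < size G) `|G`_i|.
have K_gt0 : 0 < K by rewrite ltr_pwDl // sumr_ge0.
have G_le t : 0 < t -> t <= 1 -> 'Im G.[t] <= K.
  move=> t_gt0 t_le1; apply: (le_trans (Im_le_norm _)).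
  rewrite horner_coef (le_trans (ler_norm_sum _ _ _)) //.
  rewrite -[leLHS]add0r lerD // ler_sum // => i _.
  by rewrite normrM ler_piMr // normrX (gtr0_norm t_gt0) exprn_ile1 // ltW.
have a_gt0 : 0 < 2 / e by rewrite divr_gt0.
have b_gt0 : 0 < 2 * K / - 'Im c by rewrite divr_gt0 ?mulr_gt0 ?oppr_gt0.
(* The test point is [t = 1 / s]: the three summands force [t <= 1], [t < e] and [t K < - Im c]; the
   factors 2 make the last two strict. *)
pose s := 1 + 2 / e + 2 * K / - 'Im c.
have s_gt0 : 0 < s by rewrite /s !addr_gt0.
have t_le1 : s^-1 <= 1.
  by rewrite invf_le1 // /s -addrA lerDl addr_ge0 // ltW.
have t_lte : s^-1 < e.
  rewrite -[e]invrK ltf_pV2 ?posrE ?invr_gt0 //.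
  apply: (@lt_le_trans _ _ (2 / e)); first by rewrite ltr_pMl ?invr_gt0 // ltr1n.
  by rewrite /s [1 + _]addrC -addrA lerDl addr_ge0 // ltW.
have tK : s^-1 * K < - 'Im c.
  rewrite mulrC ltr_pdivrMr // mulrC -ltr_pdivrMr ?oppr_gt0 //.
  apply: (@lt_le_trans _ _ (2 * K / - 'Im c)).
    by rewrite -mulrA ltr_pMl ?ltr1n // divr_gt0 ?oppr_gt0.
  by rewrite /s lerDr addr_ge0 // ltW.
have t_gt0 : 0 < s^-1 by rewrite invr_gt0.
have := F_ge0 _ t_gt0 t_lte; rewrite hornerMXaddC raddfD /= ImM.
rewrite (Creal_ImP _ (gtr0_real t_gt0)) mulr0 add0r (Creal_ReP _ (gtr0_real t_gt0)).
move=> h.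
have : s^-1 * 'Im G.[s^-1] <= s^-1 * K by rewrite ler_pM2l // G_le.
rewrite real_leNgt ?rpredM ?Creal_Im ?gtr0_real // => /negP; apply.
by rewrite (lt_le_trans tK) // -subr_ge0 opprK.
Qed.

(** For real [t], conjugating [V(t)] amounts to conjugating the coefficients of [V], so expressions
    with conjugates become polynomials in [t] and [Im_horner0_ge0] applies. *)
Lemma horner_mul_conj U V :
  exists F, forall t, t \is Num.real -> F.[t] = U.[t] * V.[t]^*.
Proof.
exists (U * map_poly Num.conj V) => t /CrealP t_real.
by rewrite hornerM -{2}t_real horner_map.
Qed.

Lemma Im_conj_horner0_ge0 U V e : 0 < e ->
    (forall t, 0 < t -> t < e -> 0 <= 'Im (U.[t] * V.[t]^*)) ->
  0 <= 'Im (U.[0] * V.[0]^*).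
Proof.
move=> e_gt0 UV_ge0; have [F F_eq] := horner_mul_conj U V.
rewrite -F_eq ?rpred0 //; apply: (Im_horner0_ge0 e_gt0) => t t_gt0 t_lt.
by rewrite F_eq ?gtr0_real // UV_ge0.
Qed.

Lemma norm_horner0_le U V K e : 0 < e -> 0 <= K ->
    (forall t, 0 < t -> t < e -> `|U.[t]| <= K * `|V.[t]|) ->
  `|U.[0]| <= K * `|V.[0]|.
Proof.
move=> e_gt0 K_ge0 UV_le; have [F F_eq] := horner_mul_conj U U.
have [G G_eq] := horner_mul_conj V V.
(* The factor [i] turns the real difference of squares into an imaginary part. *)
pose H := 'i *: (K ^+ 2 *: G - F).
have H_eq t : t \is Num.real -> 'Im H.[t] = (K * `|V.[t]|) ^+ 2 - `|U.[t]| ^+ 2.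
  move=> t_real; rewrite hornerZ ImMil hornerD hornerN hornerZ F_eq // G_eq //.
  rewrite -!normCK -exprMn; apply/Creal_ReP.
  by rewrite rpredB ?rpredX ?rpredM ?normr_real ?ger0_real.
rewrite -(@ler_pXn2r _ 2) ?nnegrE ?mulr_ge0 // -subr_ge0 -H_eq ?rpred0 //.
apply: (Im_horner0_ge0 e_gt0) => t t_gt0 t_lt.
by rewrite H_eq ?gtr0_real // subr_ge0 ler_pXn2r ?nnegrE ?mulr_ge0 // UV_le.
Qed.

Lemma factor_horner q : exists2 r : seq C, (size r <= size q)%N &
  [/\ (forall x, q.[x] = lead_coef q * \prod_(a <- r) (x - a)) &
      forall a, a \in r -> q.[a] = 0].
Proof.
have [r Dq] := closed_field_poly_normal q.
have q_eq x : q.[x] = lead_coef q * \prod_(a <- r) (x - a).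
  rewrite {1}Dq hornerZ horner_prod; congr (_ * _).
  by apply: eq_bigr => a _; rewrite hornerXsubC.
(* For [q = 0] the factorization does not bound the length of [r]; the empty list works because the
   leading coefficient is 0. *)
have [q0|q_neq0] := eqVneq q 0.
  by exists [::] => //; split=> // x; rewrite q0 horner0 lead_coef0 mul0r.
exists r; last split => // a a_r.
  by rewrite Dq size_scale ?lead_coef_eq0 // size_prod_XsubC.
by rewrite q_eq (big_rem a) //= subrr mul0r mulr0.
Qed.

(** Every root lies in the closed lower half plane, hence is at least as close to [-i] as to [i];
    multiply over the roots. *)
Lemma norm_horner_conj_le q :
  (forall x, 0 < 'Im x -> q.[x] != 0) -> `|q.[- 'i]| <= `|q.['i]|.
Proof.
move=> q_neq0; have [r _ [q_eq r_root]] := factor_horner q.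
rewrite !q_eq !normrM ler_wpM2l // !normr_prod !big_seq.
apply: ler_prod => a /r_root a_root; rewrite normr_ge0 /=.
have a_le0 : 'Im a <= 0.
  rewrite real_leNgt ?Creal_Im ?rpred0 //.
  by apply/negP => /q_neq0; rewrite a_root eqxx.
rewrite -(@ler_pXn2r _ 2) ?nnegrE // !normC2_Re_Im !raddfB /= !raddfN /= Re_i Im_i.
rewrite oppr0 lerD2l -subr_ge0.
have -> : (1 - 'Im a) ^+ 2 - (- 1 - 'Im a) ^+ 2 = - 'Im a * 4 by ring.
by rewrite mulr_ge0 ?oppr_ge0.
Qed.

(** Each root [a] satisfies [|a| >= e >= |x|], so [|x - a| <= 2 |a|]; multiply over the roots. *)
Lemma norm_horner_disk q e x :
    0 < e -> (forall y, `|y| < e -> q.[y] != 0) -> `|x| <= e ->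
  `|q.[x]| <= 2 ^+ size q * `|q.[0]|.
Proof.
move=> e_gt0 q_neq0 x_le; have [r size_r [q_eq r_root]] := factor_horner q.
have -> : `|q.[0]| = `|lead_coef q| * \prod_(a <- r) `|a|.
  rewrite q_eq normrM normr_prod; congr (_ * _).
  by apply: eq_bigr => a _; rewrite sub0r normrN.
rewrite q_eq normrM mulrCA ler_wpM2l // normr_prod.
apply: (@le_trans _ _ (2 ^+ size r * \prod_(a <- r) `|a|)); last first.
  by rewrite ler_wpM2r ?prodr_ge0 // ler_eXn2l // ltr1n.
have -> : 2 ^+ size r = \prod_(a <- r) 2 :> C.
  by rewrite big_const_seq count_predT -iter_mulr_1.
rewrite -big_split /= !big_seq; apply: ler_prod => a /r_root a_root.
rewrite normr_ge0 /= (le_trans (ler_normB _ _)) // mulr_natl mulr2n lerD2r.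
apply: (le_trans x_le); rewrite real_leNgt ?normr_real ?gtr0_real //.
by apply/negP => /q_neq0; rewrite a_root eqxx.
Qed.

(** If [V = X^m W] with [m > 0] and [W(0) != 0], the argument of [V] takes all values around 0 while
    that of [U] is nearly constant; along a suitable ray the imaginary part is negative. *)
Lemma poly_eq0_Im_conj U V e : 0 < e ->
    (forall x, `|x| < e -> 0 <= 'Im (U.[x] * V.[x]^*)) ->
  U.[0] != 0 -> V.[0] = 0 -> V = 0.
Proof.
move=> e_gt0 UV_ge0 U0 V0; apply/eqP/negPn/negP => V_neq0.
have [m [W]] := multiplicity_XsubC V 0.
rewrite V_neq0 subr0 /= => W0 V_eq.
have m_gt0 : (0 < m)%N.
  rewrite lt0n; apply/eqP => m0; move: W0; rewrite /root -[W]mulr1.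
  by rewrite -(expr0 'X) -[X in 'X^X]m0 -V_eq V0 eqxx.
pose c := U.[0] * W.[0]^*.
have c_neq0 : c != 0 by rewrite mulf_neq0 ?conjC_eq0.
pose w := (m.-root (- 'i * c^*))^*.
have wm : (w^* ) ^+ m = - 'i * c^* by rewrite conjCK rootCK.
(* For real [t > 0], [F(t)] is [U V^*] at [w t] divided by [t^m], and it is a polynomial in [t]. *)
pose F := (- 'i * c^* )%:P * (U \Po (w *: 'X)) *
          (map_poly Num.conj W \Po (w^* *: 'X)).
have F_eq t : t \is Num.real -> F.[t] = - 'i * c^* * U.[w * t] * W.[w * t]^*.
  move=> /CrealP t_real; rewrite !hornerM hornerC !horner_comp !hornerZ !hornerX.
  by rewrite -{2}t_real -rmorphM /= horner_map.
have w1 : 0 < `|w| + 1 by rewrite ltr_wpDl.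
suff: 0 <= 'Im F.[0].
  rewrite F_eq ?rpred0 // mulr0 -mulrA -/c -mulrA mulNr raddfN /= ImMil.
  rewrite mulrC -normCK (Creal_ReP _ _) ?rpredX ?normr_real // oppr_ge0.
  by rewrite lt_geF // exprn_gt0 ?normr_gt0.
apply: (@Im_horner0_ge0 _ (e / (`|w| + 1))) => [|t t_gt0 t_lt].
  by rewrite divr_gt0.
have t_real := gtr0_real t_gt0.
have tm_gt0 : 0 < t ^+ m by rewrite exprn_gt0.
have wt_lt : `|w * t| < e.
  move: t_lt; rewrite ltr_pdivlMr // normrM (gtr0_norm t_gt0).
  by apply: le_lt_trans; rewrite mulrC ler_pM2l // lerDl.
have := UV_ge0 _ wt_lt; rewrite V_eq hornerM horner_exp hornerX rmorphM /=.
rewrite [w * t]mulrC !exprMn !rmorphM !rmorphXn /= wm (CrealP t_real) -[t * w]mulrC.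
rewrite F_eq // => UV_ge; rewrite -(pmulr_rge0 _ tm_gt0); move: UV_ge.
have ImZ x : t ^+ m * 'Im x = 'Im (t ^+ m * x).
  have tm_real : t ^+ m \is Num.real by rewrite rpredX.
  by rewrite ImM (Creal_ImP _ tm_real) (Creal_ReP _ tm_real) mulr0 addr0.
rewrite ImZ; set x := U.[_]; set y := (W.[_])^*.
by congr (0 <= 'Im _); ring.
Qed.

End OneVariable.

(** * Lowest order terms and zeros on the product of half planes *)

Section SeveralVariables.
Variables (C : numClosedFieldType) (d : nat).
Implicit Types (p : mpoly d C) (z v : 'rV[C]_d) (t : C).

(* Kronecker: X_i := X^(N^i) separates the monomials with exponents below N. *)
Lemma peval_eq0 p : (forall z, peval p z = 0) -> p = 0.
Proof.
move=> p0; pose k (m : multinom d) := (\sum_(i < d) m i * msize p ^ i)%N.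
have lt_msize m i : m \in msupp p -> (m i < msize p)%N.
  move=> /msize_mdeg_lt; apply: leq_ltn_trans.
  by rewrite mdegE (bigD1 i) //= leq_addr.
pose K : {poly C} := \sum_(m <- msupp p) mcoeff m p *: 'X^(k m).
have K0 : K = 0.
  apply: (@poly_eq0_near0 _ _ 1) => // t _ _.
  rewrite -(p0 (\row_i t ^+ (msize p ^ i))) /peval mevalE horner_sum.
  apply: eq_bigr => m _; rewrite hornerZ hornerXn; congr (_ * _).
  rewrite /k (big_morph _ (fun a b => exprD t a b) (expr0 _)).
  by apply: eq_bigr => i _; rewrite mxE -exprM mulnC.
apply/mpolyP => m; rewrite mcoeff0; apply/eqP; rewrite mcoeff_eq0.
apply/negP => m_p; have := congr1 (fun F : {poly C} => F`_(k m)) K0.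
rewrite coef0 coef_sum (bigD1_seq m) ?msupp_uniq //= big1_seq => [|m' /andP[ne m'_p]].
  rewrite coefZ coefXn eqxx mulr1 addr0 => /eqP.
  by rewrite mcoeff_eq0 m_p.
rewrite coefZ coefXn; case: eqP => [eq_k|_]; last by rewrite mulr0.
case/eqP: ne; apply/mnmP => i; apply/esym.
apply: (@base_expansion_inj (msize p) _ (fun i => m i) (fun i => m' i)) => // {}i;
  exact: lt_msize.
Qed.

Lemma in_Hd_disk z v : in_Hd z ->
  exists2 e : C, 0 < e & forall t, `|t| < e -> in_Hd (z + t *: v).
Proof.
(* The radius is [1 / s]: [s] dominates each ratio [|v_i| / Im z_i], and the 1 keeps it positive
   when [v = 0]. *)
move=> z_H; pose s := 1 + \sum_i `|v ord0 i| / 'Im (z ord0 i).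
have sum_ge0 (P : pred 'I_d) : 0 <= \sum_(i | P i) `|v ord0 i| / 'Im (z ord0 i).
  by apply: sumr_ge0 => i _; rewrite divr_ge0 // ltW.
have s_gt0 : 0 < s by rewrite ltr_pwDl.
exists s^-1; rewrite ?invr_gt0 // => t t_lt i.
rewrite !mxE raddfD /= -ltrN2 oppr0 opprD addrC subr_lt0.
apply: (le_lt_trans (y := `|t| * `|v ord0 i|)).
  have -> : - 'Im (t * v ord0 i) = 'Im (- (t * v ord0 i)) by rewrite raddfN.
  by rewrite (le_trans (Im_le_norm _)) // normrN normrM.
have zi_gt0 := z_H i; rewrite -[ltRHS]mul1r -ltr_pdivrMr // -mulrA.
apply: (@le_lt_trans _ _ (`|t| * s)).
  by rewrite ler_wpM2l // /s (bigD1 i) //= addrCA lerDl addr_ge0.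
by rewrite -ltr_pdivlMr // mul1r.
Qed.

(** The polynomial [U] is [t^-M p(t z)], so the limit of the rescaled values as [t -> 0] becomes
    evaluation at 0. *)
Lemma lowest_term p M z : (forall j, (j < M)%N -> hcomp j p = 0) ->
  exists2 U : {poly C}, U.[0] = peval (hcomp M p) z &
    forall t, peval p (t *: z) = t ^+ M * U.[t].
Proof.
move=> p_low; exists (drop_poly M (slice p 0 z)) => [|t].
  by rewrite horner_coef0 coef_drop_poly add0n coef_slice0.
rewrite -[t *: z]add0r -horner_slice.
rewrite -{1}[slice p 0 z](poly_take_drop M).
have -> : take_poly M (slice p 0 z) = 0.
  apply/polyP => j; rewrite coef_take_poly coef0; case: ifP => // /p_low p0.
  by rewrite coef_slice0 p0 /peval meval0.
by rewrite add0r hornerM hornerXn mulrC.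
Qed.

Lemma in_Hd_scale z t : 0 < t -> in_Hd z -> in_Hd (t *: z).
Proof.
move=> t_gt0 z_H i; have t_real := gtr0_real t_gt0.
rewrite mxE ImM (Creal_ImP _ t_real) mulr0 addr0 (Creal_ReP _ t_real).
by rewrite mulr_gt0.
Qed.

Lemma peval_hcompZ k p z t :
  peval (hcomp k p) (t *: z) = t ^+ k * peval (hcomp k p) z.
Proof.
have hcomp_hcomp j : hcomp j (hcomp k p) = hcomp k p *+ (j == k).
  apply/mpolyP => m; rewrite mcoeff_hcomp mcoeffMn !mcoeff_hcomp -!mulrnA.
  congr (_ *+ _); case: (altP (j =P k)) => [->|ne]; first by case: eqP.
  by rewrite muln0; case: eqP => // ->; rewrite [k == j]eq_sym (negbTE ne).
rewrite -[t *: z]add0r -horner_slice.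
suff -> : slice (hcomp k p) 0 z = peval (hcomp k p) z *: 'X^k.
  by rewrite hornerZ hornerXn mulrC.
apply/polyP => j; rewrite coef_slice0 hcomp_hcomp coefZ coefXn /peval mevalMn.
by rewrite mulr_natr.
Qed.

(** The slice with base [Re z] and direction [Im z] takes the value [p(z)] at [i] and [p(conj z)] at
    [-i], and it has no root in the upper half plane. *)
Lemma norm_pbar_le p z : (forall v, in_Hd v -> peval p v != 0) -> in_Hd z ->
  `|peval (pbar p) z| <= `|peval p z|.
Proof.
move=> p_neq0 z_H; pose x : 'rV[C]_d := \row_i 'Re (z ord0 i).
pose y : 'rV[C]_d := \row_i 'Im (z ord0 i).
have z_eq : z = x + 'i *: y by apply/rowP => i; rewrite !mxE -Crect.
have z_conj : map_mx Num.conj z = x + - 'i *: y.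
  apply/rowP => i; rewrite !mxE {1}[z ord0 i]Crect rmorphD rmorphM /= conjCi.
  by rewrite !(CrealP _) ?Creal_Re ?Creal_Im.
rewrite pbarE norm_conjC z_conj z_eq -!horner_slice.
apply: norm_horner_conj_le => a a_gt0; rewrite horner_slice; apply: p_neq0 => i.
rewrite !mxE raddfD /= ImM (Creal_ImP _ (Creal_Re _)).
rewrite (Creal_ImP _ (Creal_Im _)) (Creal_ReP _ (Creal_Im _)) mulr0 !add0r.
by rewrite mulr_gt0.
Qed.

(* Hurwitz: a zero of the limit [hcomp M p] of the stable polynomials
   [t^-M * p (t z)] would force it to vanish identically on a disk, since a
   polynomial of bounded degree without zeros in a disk is controlled there by
   its value at the centre. *)
Lemma hcomp_stable_neq0 p M :
    (forall z, in_Hd z -> peval p z != 0) ->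
    (forall j, (j < M)%N -> hcomp j p = 0) -> hcomp M p != 0 ->
  forall z, in_Hd z -> peval (hcomp M p) z != 0.
Proof.
move=> p_neq0 p_low PM_neq0 z z_H; apply/eqP => PM_z; case/eqP: PM_neq0.
apply: peval_eq0 => w; pose v := w - z.
have [e e_gt0 disk] := in_Hd_disk v z_H.
have -> : w = z + 1 *: v by rewrite scale1r addrC subrK.
rewrite -horner_slice (@poly_eq0_near0 _ (slice (hcomp M p) z v) e) ?horner0 //.
move=> a a_gt0 a_lt; rewrite horner_slice.
have [U U0 U_eq] := lowest_term (z + a *: v) p_low.
have [V V0 V_eq] := lowest_term z p_low.
apply/normr0_eq0/le_anti; rewrite normr_ge0 andbT -U0.
have := @norm_horner0_le _ U V (2 ^+ msize p) 1.
rewrite V0 PM_z normr0 mulr0; apply; rewrite ?exprn_ge0 // => t t_gt0 _.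
have tM_gt0 : 0 < `|t ^+ M| by rewrite normr_gt0 expf_neq0 ?gt_eqF.
rewrite -(ler_pM2l tM_gt0) mulrCA -!normrM -U_eq -V_eq.
(* Scaling the line together with its direction keeps the zero-free disk in the parameter at radius
   [e] for every [t]. *)
have scale_line b : t *: (z + b *: v) = t *: z + b *: (t *: v).
  by rewrite scalerDr !scalerA mulrC.
have := @norm_horner_disk _ (slice p (t *: z) (t *: v)) e a e_gt0.
rewrite !horner_slice scale0r addr0 -scale_line.
move=> H; apply: le_trans (H _ _) _; last first.
- by rewrite ler_wpM2r // ler_eXn2l ?ltr1n // size_slice.
- by rewrite gtr0_norm // ltW.
move=> y y_lt; rewrite horner_slice -scale_line.
by apply/p_neq0/in_Hd_scale/disk.
Qed.

Lemma hcomp_Im_conj_ge0 (A B : mpoly d C) M k :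
    (forall z, in_Hd z -> 0 <= 'Im (peval A z * (peval B z)^*)) ->
    (forall j, (j < M)%N -> hcomp j A = 0) ->
    (forall j, (j < k)%N -> hcomp j B = 0) ->
  forall z, in_Hd z -> 0 <= 'Im (peval (hcomp M A) z * (peval (hcomp k B) z)^*).
Proof.
move=> AB_ge0 A_low B_low z z_H.
have [U <- U_eq] := lowest_term z A_low; have [V <- V_eq] := lowest_term z B_low.
apply: (@Im_conj_horner0_ge0 _ _ _ 1) => // t t_gt0 _.
have := AB_ge0 _ (in_Hd_scale t_gt0 z_H).
have t_real := gtr0_real t_gt0; have tn_gt0 : 0 < t ^+ (M + k) by rewrite exprn_gt0.
have tn_real := gtr0_real tn_gt0.
rewrite U_eq V_eq rmorphM rmorphXn /= (CrealP t_real) mulrACA -exprD ImM.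
by rewrite (Creal_ImP _ tn_real) mulr0 addr0 (Creal_ReP _ tn_real) pmulr_rge0.
Qed.

(** If [B] vanished at [z], the one-variable lemma would make it vanish on every complex line
    through [z], hence everywhere. *)
Lemma peval_neq0_Im_conj (A B : mpoly d C) :
    (forall z, in_Hd z -> 0 <= 'Im (peval A z * (peval B z)^*)) ->
    (forall z, in_Hd z -> peval A z != 0) -> B != 0 ->
  forall z, in_Hd z -> peval B z != 0.
Proof.
move=> AB_ge0 A_neq0 B_neq0 z z_H; apply/eqP => Bz0; case/eqP: B_neq0.
apply: peval_eq0 => w; pose v := w - z.
have [e e_gt0 disk] := in_Hd_disk v z_H.
have -> : w = z + 1 *: v by rewrite scale1r addrC subrK.
rewrite -horner_slice (@poly_eq0_Im_conj _ (slice A z v) (slice B z v) e) ?horner0 //.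
- by move=> x /disk x_H; rewrite !horner_slice AB_ge0.
- by rewrite horner_slice scale0r addr0 A_neq0.
- by rewrite horner_slice scale0r addr0.
Qed.

End SeveralVariables.

(** * Real and imaginary parts of [p], degrees in a homogeneous Pick quotient, differentiability *)

Section RealParts.
Variables (C : numClosedFieldType) (d : nat).
Implicit Types (p : mpoly d C) (z : 'rV[C]_d).

Lemma mcoeff_Apart m p : mcoeff m (Apart p) = 'Re (mcoeff m p).
Proof. by rewrite mcoeffZ mcoeffD mcoeff_map_mpoly ReE mulrC. Qed.

Lemma mcoeff_Bpart m p : mcoeff m (Bpart p) = 'Im (mcoeff m p).
Proof.
rewrite mcoeffZ mcoeffB mcoeff_map_mpoly ImE invfM invCi; ring.
Qed.

(** With [a = p(z)] and [b = pbar(z)], [A B^* = i (a + b)(a - b)^* / 4], and the cross terms of the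
    product are purely imaginary. *)
Lemma Im_Apart_conj_Bpart p z :
  'Im (peval (Apart p) z * (peval (Bpart p) z)^*) =
  (`|peval p z| ^+ 2 - `|peval (pbar p) z| ^+ 2) / 4.
Proof.
rewrite /Apart /Bpart /peval !mevalZ mevalD mevalB -/(peval p z).
rewrite -/(peval (pbar p) z); set a := peval p z; set b := peval _ z.
have -> : 2^-1 * (a + b) * ((2 * 'i)^-1 * (a - b))^* =
    'i * ((a + b) * (a - b)^* / 4).
  have i4 : 4^-1 = 2^-1 * 2^-1 :> C by rewrite -invfM -natrM.
  rewrite invfM invCi !rmorphM /= fmorphV rmorph_nat rmorphN /= conjCi opprK i4.
  ring.
rewrite ImMil ReE !rmorphM /= fmorphV rmorph_nat !rmorphD !rmorphN /= !conjCK.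
by rewrite !normCK; field.
Qed.

Lemma peval_real p z : p \is a mpolyOver d Num.real ->
  (forall i, z ord0 i \is Num.real) -> peval p z \is Num.real.
Proof.
move=> /mpolyOverP p_real z_real; rewrite /peval mevalE rpred_sum // => m _.
by rewrite rpredM // rpred_prod // => i _; rewrite rpredX.
Qed.

(* On the diagonal z = (w, ..., w) the two forms are w^M and w^k up to real
   factors, and w^(k - M) would take both values i and -i on the upper half
   plane if k - M > 1. *)
Lemma homogeneous_Pick_degree (A B : mpoly d C) M k :
    hcomp M A \is a mpolyOver d Num.real -> hcomp k B \is a mpolyOver d Num.real ->
    (forall z, in_Hd z -> 0 <= 'Im (peval (hcomp M A) z * (peval (hcomp k B) z)^*)) ->
    (forall z, in_Hd z -> peval (hcomp M A) z != 0) ->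
    (forall z, in_Hd z -> peval (hcomp k B) z != 0) ->
  (k <= M.+1)%N.
Proof.
move=> A_real B_real AB_ge0 A_neq0 B_neq0; rewrite leqNgt; apply/negP => M_lt.
pose one : 'rV[C]_d := const_mx 1.
have one_H w : 0 < 'Im w -> in_Hd (w *: one) by move=> w_gt0 i; rewrite !mxE mulr1.
have one_real i : one ord0 i \is Num.real by rewrite mxE rpred1.
have := peval_real A_real one_real; have := peval_real B_real one_real.
have i_H : in_Hd ('i *: one) by apply: one_H; rewrite Im_i.
have := A_neq0 _ i_H; have := B_neq0 _ i_H; rewrite !peval_hcompZ.
set a := peval (hcomp M A) one; set b := peval (hcomp k B) one.
rewrite !mulf_eq0 !negb_or => /andP[_ b_neq0] /andP[_ a_neq0] b_real a_real.
pose n := (k - M)%N; have n_gt1 : (1 < n)%N by rewrite ltn_subRL addn1.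
have k_eq : k = (M + n)%N by rewrite subnKC // ltnW // ltnW.
have ab_real : a * b \is Num.real by rewrite rpredM.
(* For [n >= 2] the chosen [n]-th root of a nonreal [c] lies in the open upper half plane, so [w^n]
   reaches every nonreal value; [c = i] and [c = -i] then force [a b = 0]. *)
have sign c : 'Im c != 0 -> 0 <= 'Im c^* * (a * b).
  move=> c_neq0; pose w := n.-root c.
  have wn : w ^+ n = c by rewrite rootCK // ltnW.
  have w_gt0 : 0 < 'Im w.
    rewrite lt_def Im_rootC_ge0 // andbT; apply: contra c_neq0 => /eqP w0.
    by rewrite -wn (Creal_ImP _ _) // rpredX //; apply/Creal_ImP.
  have := AB_ge0 _ (one_H _ w_gt0); rewrite !peval_hcompZ -/a -/b.
  rewrite k_eq exprD wn !rmorphM /= (CrealP b_real).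
  have -> : w ^+ M * a * ((w ^+ M)^* * c^* * b) = `|w ^+ M| ^+ 2 * (a * b) * c^*.
    by rewrite normCK; ring.
  have w_neq0 : w != 0 by apply: contraL w_gt0 => /eqP ->; rewrite raddf0 ltxx.
  rewrite ImM.
  have r_real : `|w ^+ M| ^+ 2 * (a * b) \is Num.real.
    by rewrite rpredM // rpredX // normr_real.
  rewrite (Creal_ImP _ r_real) (Creal_ReP _ r_real) mulr0 addr0 -mulrA.
  rewrite pmulr_rge0 ?exprn_gt0 ?normr_gt0 ?expf_neq0 //.
  by rewrite mulrC.
have /eqP := mulf_neq0 a_neq0 b_neq0; apply; apply/le_anti.
have := sign 'i; have := sign (- 'i).
rewrite !Im_conj raddfN /= Im_i opprK mulN1r mul1r oppr_eq0 oppr_ge0 oner_eq0.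
by move=> -> // ->.
Qed.

Lemma differentiable_peval p z : differentiable (peval p) z.
Proof.
have eq_diff (f g : 'rV[C]_d -> C) :
    f =1 g -> differentiable g z -> differentiable f z by move=> /boolp.funext ->.
have diff_exp i n : differentiable (fun w : 'rV[C]_d => w ord0 i ^+ n) z.
  elim: n => [|n IH].
    by apply: (eq_diff _ (fun _ => 1)) => // w; rewrite expr0.
  apply: (eq_diff _ (fun w => w ord0 i * w ord0 i ^+ n)) => [w|].
    by rewrite exprS.
  by apply: differentiableM => //; apply: differentiable_coord.
have diff_prod (m : multinom d) (r : seq 'I_d) :
    differentiable (fun w : 'rV[C]_d => \prod_(i <- r) w ord0 i ^+ m i) z.
  elim: r => [|i r IH].
    by apply: (eq_diff _ (fun _ => 1)) => // w; rewrite big_nil.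
  apply: (eq_diff _
    (fun w => w ord0 i ^+ m i * \prod_(j <- r) w ord0 j ^+ m j)) => [w|].
    by rewrite big_cons.
  exact: differentiableM.
elim/mpolyind: p => [|c m p _ _ IH].
  by apply: (eq_diff _ (fun _ => 0)) => // w; rewrite /peval meval0.
apply: (eq_diff _ (fun w =>
    c * \prod_(i <- index_enum 'I_d) w ord0 i ^+ m i + peval p w)) => [w|].
  by rewrite /peval mevalD mevalZ mevalX.
by apply: differentiableD => //; apply: differentiableM.
Qed.

End RealParts.

(** * Orders of vanishing of [A] and [B], and the Pick property of the quotient *)

Unset Implicit Arguments.

Theorem proposition2p7 (R : realType) (d M : nat) (p : mpoly d R[i])
    (p_pure_stable : pure_stable p)
    (p_at0 : peval p 0 = 0)
    (p_low : forall j : nat, (j < M)%N -> hcomp j p = 0)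
    (PM_neq0 : hcomp M p != 0)
    (PM_real : hcomp M p \is a mpolyOver d Num.real) :
  let A_M := hcomp M (Apart p) in
  let B_M1 := hcomp M.+1 (Bpart p) in
  (forall z, in_Hd z -> peval B_M1 z != 0) /\
  pick_function (fun z => peval A_M z / peval B_M1 z).
Proof.
move=> A_M B_M1; have [p_neq0 p_pure] := p_pure_stable.
have coef_low m : (mdeg m < M)%N -> mcoeff m p = 0.
  by move=> /p_low /(congr1 (mcoeff m)); rewrite mcoeff_hcomp eqxx mcoeff0.
have coef_M m : mdeg m = M -> mcoeff m p \is Num.real.
  move=> m_M; have /mpolyOverP /(_ m) := PM_real.
  by rewrite mcoeff_hcomp m_M eqxx.
have A_low j : (j < M)%N -> hcomp j (Apart p) = 0.
  move=> j_lt; apply/mpolyP => m; rewrite mcoeff_hcomp mcoeff_Apart mcoeff0.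
  by case: eqP => [m_j|_] //; rewrite coef_low ?m_j // raddf0.
have B_low j : (j < M.+1)%N -> hcomp j (Bpart p) = 0.
  rewrite ltnS leq_eqVlt => j_le; apply/mpolyP => m.
  rewrite mcoeff_hcomp mcoeff_Bpart mcoeff0; case: eqP => [m_j|_] //.
  (* In degree [M] the coefficients of [B] are imaginary parts of those of [P_M], which are real. *)
  case/orP: j_le => [/eqP j_M|j_lt]; last by rewrite coef_low ?m_j // raddf0.
  by apply/Creal_ImP/coef_M; rewrite m_j.
have A_M_eq : A_M = hcomp M p.
  apply/mpolyP => m; rewrite !mcoeff_hcomp mcoeff_Apart.
  by case: eqP => [/coef_M /Creal_ReP ->|].
have AB_ge0 z : in_Hd z -> 0 <= 'Im (peval (Apart p) z * (peval (Bpart p) z)^*).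
  move=> z_H; rewrite Im_Apart_conj_Bpart divr_ge0 // subr_ge0.
  by rewrite ler_pXn2r ?nnegrE // norm_pbar_le.
have A_neq0 z : in_Hd z -> peval A_M z != 0.
  by rewrite A_M_eq; apply: hcomp_stable_neq0.
have B_neq0 : exists k, hcomp k (Bpart p) != 0.
  suff [m Bm] : exists m, mcoeff m (Bpart p) != 0.
    exists (mdeg m); apply: contra Bm => /eqP /(congr1 (mcoeff m)).
    by rewrite mcoeff_hcomp eqxx mcoeff0 => /eqP.
  (* If [B = 0], then [p = pbar] is a common factor of itself and its conjugate, hence constant by
     purity; [p(0) = 0] makes it 0, against [P_M != 0]. *)
  apply/boolp.not_existsP => B0.
  have p_real : pbar p = p.
    apply/mpolyP => m; rewrite mcoeff_map_mpoly; apply/CrealP/Creal_ImP.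
    by rewrite -mcoeff_Bpart; apply/eqP/negPn/negP/B0.
  have [c p_c] : exists c, p = mpolyC d c by apply: (p_pure p 1 1); rewrite ?p_real mulr1.
  move: p_at0 PM_neq0; rewrite p_c /peval mevalC => ->.
  by rewrite mpolyC0 /hcomp pihomog0 eqxx.
have B_real k : hcomp k (Bpart p) \is a mpolyOver d Num.real.
  by apply/mpolyOverP => m; rewrite mcoeff_hcomp mcoeff_Bpart rpredMn ?Creal_Im.
case: (ex_minnP B_neq0) => k Bk_neq0 k_min.
have Bk_low j : (j < k)%N -> hcomp j (Bpart p) = 0.
  by move=> j_lt; apply/eqP/negPn/negP => /k_min; rewrite leqNgt j_lt.
have ABk_ge0 := hcomp_Im_conj_ge0 AB_ge0 A_low Bk_low.
have Bk_stable := peval_neq0_Im_conj ABk_ge0 A_neq0 Bk_neq0.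
have A_real : A_M \is a mpolyOver d Num.real by rewrite A_M_eq.
have k_le := homogeneous_Pick_degree A_real (B_real k) ABk_ge0 A_neq0 Bk_stable.
have k_eq : k = M.+1.
  apply/eqP; rewrite eqn_leq k_le ltnNge -ltnS.
  by apply: contra Bk_neq0 => /B_low ->.
rewrite {}k_eq in ABk_ge0 Bk_stable; split=> // z z_H; split.
  apply: differentiableM; first exact: differentiable_peval.
  by apply: differentiableV; [exact: differentiable_peval|exact: Bk_stable].
have B_gt0 : 0 < `|peval B_M1 z| ^- 2.
  by rewrite invr_gt0 exprn_gt0 // normr_gt0 Bk_stable.
have B_gt0_real := gtr0_real B_gt0.
(* Here [A_M / B_{M+1}] is [A_M B_{M+1}^*] times the positive number [|B_{M+1}|^-2]. *)
rewrite invC_norm mulrCA ImM (Creal_ImP _ B_gt0_real) mulr0 addr0.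
by rewrite (Creal_ReP _ B_gt0_real) pmulr_rge0 // ABk_ge0.
Qed.
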